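(* Let $A\in S_n(\mathbb{Z})$. If $\Delta_A$ is odd and square-free, then for every $Q\in O_n(\mathbb{Q})$ with $Q^{T}AQ\in S_n(\mathbb{Z})$, the matrix $Q$ is a signed permutation matrix.
   Context: $S_n(\mathbb{Z})$ is the set of all symmetric $n\times n$ matrices with integer entries. $O_n(\mathbb{Q})$ is the set of all $n\times n$ orthogonal matrices with rational entries. For $A\in S_n(\mathbb{Z})$, let $\phi(x)=\det(xI-A)$ be its characteristic polynomial, with roots $\alpha_1,\dots,\alpha_n\in\mathbb{C}$ (with multiplicity); the discriminant of $A$ is $\Delta_A=\prod_{i<j}(\alpha_i-\alpha_j)^2$, an integer, equal to $\pm\operatorname{Res}(\phi,\phi')$, where $\operatorname{Res}$ denotes the resultant. A signed permutation matrix is a square matrix in which each row and each column has exactly one non-zero entry, and that entry is $1$ or $-1$. *)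

(* Defs.v *)
From HB Require Import structures.
From mathcomp Require Import all_boot all_order all_algebra all_field.

Set Implicit Arguments.
Unset Strict Implicit.
Unset Printing Implicit Defensive.

Import Order.TTheory GRing.Theory Num.Theory.
Local Open Scope ring_scope.

(* S_n(Z), seen inside the rational matrices. *)
Definition in_SnZ (n : nat) (M : 'M[rat]_n) : Prop :=
  M^T = M /\ M \is a mxOver Num.int.

Definition in_OnQ (n : nat) (Q : 'M[rat]_n) : Prop := Q^T *m Q = 1%:M.

Definition signed_perm_mx (n : nat) (Q : 'M[rat]_n) : Prop :=
  [/\ forall i, exists! j, Q i j != 0,
      forall j, exists! i, Q i j != 0
    & forall i j, Q i j != 0 -> Q i j = 1 \/ Q i j = -1].

(* 0 is not square-free, since 0 ^+ 2 divides it. *)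
Definition squarefreez (m : int) : Prop :=
  forall d : int, (d ^+ 2 %| m)%Z -> d = 1 \/ d = -1.

(* The n complex roots of the characteristic polynomial, with multiplicity;
   they are algebraic numbers, so algC is used for the complex field. *)
Definition char_roots (n : nat) (A : 'M[int]_n) : seq algC :=
  sval (closed_field_poly_normal (map_poly intr (char_poly A))).

Definition discrC (n : nat) (A : 'M[int]_n) : algC :=
  \prod_(i < n) \prod_(j < n | (i < j)%N)
     ((char_roots A)`_i - (char_roots A)`_j) ^+ 2.

(* discrC A as an element of int; nothing is lost by the floor, see discrE. *)
Definition discr (n : nat) (A : 'M[int]_n) : int := Num.floor (discrC A).

Lemma char_rootsP (n : nat) (A : 'M[int]_n) :
  map_poly intr (char_poly A) = \prod_(z <- char_roots A) ('X - z%:P).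
Proof.
rewrite /char_roots; case: closed_field_poly_normal => r /= {1}->.
by rewrite (monicP _) ?scale1r // monic_map // char_poly_monic.
Qed.

Lemma size_char_roots (n : nat) (A : 'M[int]_n) : size (char_roots A) = n.
Proof.
apply: succn_inj; rewrite -(size_prod_XsubC _ id) -char_rootsP.
rewrite size_map_poly_id0 ?size_char_poly //.
by rewrite (monicP (char_poly_monic A)) rmorph1 oner_eq0.
Qed.

Lemma char_poly_conj (R : comUnitRingType) (n : nat) (P M : 'M[R]_n) :
  P \in unitmx -> char_poly (invmx P *m M *m P) = char_poly M.
Proof.
move=> uP; rewrite /char_poly.
have -> : char_poly_mx (invmx P *m M *m P) =
    map_mx polyC (invmx P) *m char_poly_mx M *m map_mx polyC P.
  rewrite /char_poly_mx mulmxBr mulmxBl !map_mxM; congr (_ - _).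
  by rewrite scalar_mxC -mulmxA -map_mxM mulVmx // map_mx1 mulmx1.
rewrite !det_mulmx mulrAC -det_mulmx -map_mxM mulVmx //.
by rewrite map_mx1 det1 mul1r.
Qed.

Lemma trace_expmx_char_roots (n : nat) (A : 'M[int]_n) (k : nat) :
  A^T = A ->
  \sum_(i < n) (char_roots A)`_i ^+ k = (\tr (A ^+ k))%:~R.
Proof.
move=> symA; set B : 'M[algC]_n := map_mx intr A.
have BN : B \is normalmx.
  apply: symmetric_normalmx.
    apply/is_hermitianmxP; rewrite expr0 scale1r map_mx_id //.
    by rewrite /B map_trmx symA.
  by apply/mxOverP=> i j; rewrite mxE realz.
have /orthomx_spectralP := BN.
set P := spectralmx B; set d := spectral_diag B => Beq.
have uP : P \in unitmx by apply: unitarymx_unit; apply: spectral_unitarymx.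
have rootsE : perm_eq (char_roots A) [seq d 0 i | i <- enum 'I_n].
  have := char_rootsP A; rewrite map_char_poly -/B Beq char_poly_conj //.
  rewrite char_poly_trig ?diag_mx_is_trig // => H.
  apply: prod_XsubC_eq; rewrite -H big_map big_enum /=.
  by apply: eq_bigr => i _; rewrite mxE eqxx.
have Bexp : B ^+ k = invmx P *m diag_mx (\row_i d 0 i ^+ k) *m P.
  elim: k => [|k IH].
    have -> : (\row_i d 0 i ^+ 0) = const_mx 1 by apply/rowP=> i; rewrite !mxE.
    by rewrite diag_const_mx mulmx1 mulVmx.
  rewrite exprSr IH Beq -mulmxE !mulmxA mulmxK //.
  rewrite -(mulmxA (invmx P) (diag_mx _) (diag_mx _)) mulmx_diag.
  congr (_ *m diag_mx _ *m _).
  by apply/rowP=> i; rewrite !mxE exprSr.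
have -> : (\tr (A ^+ k))%:~R = \tr (B ^+ k).
  by rewrite -trace_map_mx rmorphXn.
rewrite Bexp mxtrace_mulC mulmxA mulmxV // mul1mx mxtrace_diag.
have -> : \sum_(i < n) (char_roots A)`_i ^+ k = \sum_(z <- char_roots A) z ^+ k.
  by rewrite (big_nth 0) size_char_roots big_mkord.
rewrite (perm_big _ rootsE) /= big_map big_enum /=.
by apply: eq_bigr => i _; rewrite mxE.
Qed.

Lemma discrE (n : nat) (A : 'M[int]_n) :
  A^T = A -> (discr A)%:~R = discrC A.
Proof.
move=> symA; rewrite /discr floorK //.
pose a : 'rV[algC]_n := \row_i (char_roots A)`_i.
pose V := Vandermonde n a.
have -> : discrC A = \det (V *m V^T).
  rewrite det_mulmx det_tr det_Vandermonde -big_split /=; apply: eq_bigr => i _.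
  rewrite -big_split /=; apply: eq_bigr => j _.
  by rewrite !mxE -expr2 -sqrrN opprB.
have -> : V *m V^T = map_mx intr (\matrix_(i < n, j < n) \tr (A ^+ (i + j))).
  apply/matrixP=> i j; rewrite !mxE -trace_expmx_char_roots //.
  by apply: eq_bigr => l _; rewrite !mxE exprD.
by rewrite det_map_mx intr_int.
Qed.

(* Main.v *)
Require Import Defs.
From mathcomp Require Import all_boot all_order all_algebra all_field.
From mathcomp Require Import ring.
Import Order.TTheory GRing.Theory Num.Theory.
Local Open Scope ring_scope.

(** The proof shows that if [Q] is not integral, then [p ^ 2] divides the
discriminant of [A] for every prime [p] dividing the least [l > 0] with [l Q]
integral; an integral orthogonal matrix is a signed permutation matrix because
its rows and columns are integer vectors of length 1.

Let [phi] be the characteristic polynomial of [A] and [M = phi'(A)], a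
symmetric integer matrix whose determinant is, up to sign, the discriminant:
both are the product of [phi'(a)] over the roots [a] of [phi]
([det_horner_deriv_char_poly]).  Put [X = l Q] and [B = Q^T A Q], so that
[A X = X B] and [X^T X = l ^ 2].  For a column [v] of [X] that does not vanish
mod [p], which exists because [l] is minimal:

- [v^T M v] is divisible by [p ^ 2], since [X^T M X = l ^ 2 phi'(B)];
- [M v] is divisible by [p].  Indeed, the column space of [X] mod [p] is
  invariant under [A] and totally isotropic, as [X^T X = 0] mod [p].  If [g] is
  the characteristic polynomial of [A] on this space, then [A] induces the
  transposed action on the quotient by the orthogonal space, so [g ^ 2] divides
  [phi] mod [p] ([isotropic_char_poly_sqr_dvd]).  Hence [g] divides [phi'] mod
  [p], and [phi'(A)] kills the space by Cayley-Hamilton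
  ([isotropic_deriv_char_poly]).

In a basis of the p-local lattice that starts with [v], the form [M] has its
first row and column divisible by [p] and its first diagonal entry divisible by
[p ^ 2], so [p ^ 2] divides [det M] ([sqr_dvd_det]). *)

(** * Polynomials in a matrix *)

Lemma horner_mx_intertwine (R : comNzRingType) (m n : nat) (W : 'M[R]_(m.+1, n.+1))
    (A : 'M_n.+1) (B : 'M_m.+1) (q : {poly R}) :
  W *m A = B *m W -> W *m horner_mx A q = horner_mx B q *m W.
Proof.
move=> WA; elim/poly_ind: q => [|q c IHq]; first by rewrite !rmorph0 mul0mx mulmx0.
rewrite !rmorphD !rmorphM /= !horner_mx_X !horner_mx_C mulmxDr mulmxDl scalar_mxC.
by rewrite -!mulmxE mulmxA IHq -!mulmxA WA.
Qed.

Lemma trmx_horner_mx (R : comNzRingType) (n : nat) (A : 'M[R]_n.+1) (q : {poly R}) :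
  (horner_mx A q)^T = horner_mx A^T q.
Proof.
elim/poly_ind: q => [|q c IHq]; first by rewrite !rmorph0 trmx0.
rewrite !rmorphD !rmorphM /= !horner_mx_X !horner_mx_C raddfD /= tr_scalar_mx.
rewrite -mulmxE trmx_mul IHq; congr (_ + _).
exact: comm_mx_horner.
Qed.

(** * Totally isotropic invariant subspaces *)

Lemma row_free_unit_extension (F : fieldType) (r s : nat) (W : 'M[F]_(r, r + s)) :
  row_free W -> exists Z : 'M_(s, r + s), col_mx W Z \in unitmx.
Proof.
move=> /eqP rkW; pose U := row_ebase W; exists (dsubmx U).
have -> : col_mx W (dsubmx U) = block_mx (col_ebase W) 0 0 1%:M *m U.
  rewrite -[X in _ *m X](vsubmxK U) mul_block_col !mul0mx mul1mx addr0 add0r.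
  rewrite -{1}(mulmx_ebase W) rkW pid_mx_row -/U -[X in _ *m X](vsubmxK U) -mulmxA.
  by rewrite mul_row_col mul1mx mul0mx addr0.
by rewrite unitmx_mul row_ebase_unit andbT unitmxE det_ublock det1 mulr1
           -unitmxE col_ebase_unit.
Qed.

(** Complete the rows of [W] to a basis [V]. Since [W W^T = 0], the congruent
matrix [V (x - A) V^T] has a zero upper left block and off-diagonal blocks
[(x - G) S] and [S^T (x - G)^T]; so [det (x - G)] can be extracted once from the
upper rows and once from the left columns. *)
Lemma isotropic_char_poly_sqr_dvd (F : fieldType) (r s : nat)
    (A : 'M[F]_(r + s)) (W : 'M_(r, r + s)) (G : 'M_r) :
  A^T = A -> row_free W -> W *m A = G *m W -> W *m W^T = 0 ->
  char_poly G ^+ 2 %| char_poly A.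
Proof.
move=> symA /row_free_unit_extension[Z uV] WA WW.
pose V := col_mx W Z; pose P m n := @map_mx F {poly F} polyC m n.
pose S := P _ _ (W *m Z^T).
pose D := P _ _ Z *m char_poly_mx A *m P _ _ Z^T.
have WcA : P _ _ W *m char_poly_mx A = char_poly_mx G *m P _ _ W.
  by rewrite /char_poly_mx mulmxBr mulmxBl -!map_mxM WA scalar_mxC.
have cAT : (char_poly_mx A)^T = char_poly_mx A.
  by rewrite /char_poly_mx raddfB /= tr_scalar_mx map_trmx symA.
have congrV : P _ _ V *m char_poly_mx A *m (P _ _ V)^T =
    block_mx (char_poly_mx G) 0 0 1%:M *m block_mx 0 S S^T D
      *m block_mx (char_poly_mx G)^T 0 0 1%:M.
  rewrite !mulmx_block !(mul0mx, mulmx0, mul1mx, mulmx1, addr0, add0r).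
  rewrite {1}/P map_col_mx mul_col_mx /P map_col_mx tr_col_mx mul_col_row.
  rewrite -!/(P _ _ _) !WcA /S /D; congr block_mx.
  - by rewrite -mulmxA /P map_trmx -map_mxM WW map_mx0 mulmx0.
  - by rewrite -mulmxA /P map_trmx -map_mxM.
  - have := congr1 trmx WcA; rewrite !trmx_mul cAT -mulmxA => ->.
    by rewrite mulmxA /P !map_trmx -map_mxM trmx_mul trmxK.
  by rewrite /P map_trmx.
move/(congr1 determinant): congrV.
rewrite !det_mulmx !det_ublock !det_tr !det1 !mulr1 det_map_mx.
rewrite -!/(char_poly _) => detE.
have nzV : (\det V)%:P != 0 by rewrite polyC_eq0 -unitfE -unitmxE.
have dvdV : char_poly G ^+ 2 %| (\det V)%:P * char_poly A * (\det V)%:P.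
  by rewrite detE mulrAC -expr2 dvdp_mulr.
move: dvdV; rewrite mulrC mulrA -rmorphM /= mul_polyC dvdpZr //.
by rewrite mulf_neq0 // -polyC_eq0.
Qed.

(** Let [g] be the characteristic polynomial of the action of [A] on the row space
of [Y]. Then [g ^ 2] divides [char_poly A], so [g] divides the derivative of
[char_poly A], while [g(A)] vanishes on that space by Cayley-Hamilton. *)
Lemma isotropic_deriv_char_poly (F : fieldType) (m n : nat) (A : 'M[F]_n.+1)
    (Y : 'M_(m, n.+1)) (B : 'M_m) :
  A^T = A -> Y *m A = B *m Y -> Y *m Y^T = 0 ->
  Y *m horner_mx A (char_poly A)^`() = 0.
Proof.
move=> symA YA YY; pose W := row_base Y; set M := horner_mx _ _.
suff WM : W *m M = 0.
  have /submxP[C ->] : (Y <= W)%MS by rewrite eq_row_base.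
  by rewrite -mulmxA WM mulmx0.
have /submxP[G WA] : (W *m A <= W)%MS.
  rewrite (eqmxMr _ (eq_row_base Y)) YA.
  by rewrite eq_row_base submxMl.
have WW : W *m W^T = 0.
  have /submxP[C WE] : (W <= Y)%MS by rewrite eq_row_base.
  by rewrite WE trmx_mul mulmxA -(mulmxA C) YY mulmx0 mul0mx.
have freeW : row_free W by exact: row_base_free.
have := rank_leq_col Y; move: W G WA WW freeW {YA}.
case: (\rank Y) => [|r] W G WA WW freeW; first by rewrite flatmx0.
(* Writing n as r + s makes the square matrices split along the basis W. *)
rewrite ltnS => /subnKC; move: (n - r)%N => s ns.
move: A Y symA YY @M W WA WW freeW; rewrite -ns => A Y symA _ M W WA WW freeW.
rewrite /M (horner_mx_intertwine _ _ _ _ _ _ _ WA).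
have /dvdpP[h chA] : char_poly G ^+ 2 %| char_poly A.
  by apply: (isotropic_char_poly_sqr_dvd _ r.+1 s A W G).
have -> : (char_poly A)^`() =
    (h^`() * char_poly G + h * (char_poly G)^`() *+ 2) * char_poly G.
  rewrite chA derivM expr2 derivM; ring.
by rewrite rmorphM /= Cayley_Hamilton mulr0 mul0mx.
Qed.

(** * The discriminant as a determinant *)

(** Splitting [q] into linear factors [X - w] reduces this to the values
[det (w - A) = \prod_z (w - z)] of the characteristic polynomial, up to signs
that cancel. *)
Lemma det_horner_mx (F : closedFieldType) (n : nat) (A : 'M[F]_n.+1)
    (q : {poly F}) (s : seq F) :
  char_poly A = \prod_(z <- s) ('X - z%:P) ->
  \det (horner_mx A q) = \prod_(z <- s) q.[z].
Proof.
move=> chA; have size_s : size s = n.+1.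
  by apply: succn_inj; rewrite -(size_prod_XsubC _ id) -chA size_char_poly.
have [r ->] := closed_field_poly_normal q; set c := lead_coef q.
rewrite linearZ detZ /= rmorph_prod /= -{1}size_s.
under [RHS]eq_bigr do rewrite hornerZ horner_prod.
rewrite big_split /= big_const_seq count_predT iter_mulr_1 exchange_big /=.
congr (_ * _).
have -> : \det (\prod_(w <- r) horner_mx A ('X - w%:P)) =
    \prod_(w <- r) \det (horner_mx A ('X - w%:P)).
  exact: (big_morph determinant (@det_mulmx _ _) (det1 _ _)).
apply: eq_bigr => w _; rewrite rmorphB /= horner_mx_X horner_mx_C.
have -> : A - w%:M = -1 *: (w%:M - A) by rewrite scaleN1r opprB.
have -> : \det (-1 *: (w%:M - A)) = (-1) ^+ size s * (char_poly A).[w].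
  rewrite detZ size_s -horner_evalE -det_map_mx; congr (_ * \det _).
  apply/matrixP=> i j; rewrite !mxE /= /horner_eval.
  by rewrite hornerD hornerN hornerC hornerMn hornerX.
rewrite chA horner_prod -[size s]count_predT -iter_mulr_1 -big_const_seq -big_split.
by apply: eq_bigr => z _; rewrite /= !hornerXsubC mulN1r opprB.
Qed.

(** Both sides are, up to sign, the product of [a_i - a_j] over the ordered pairs
[i != j] of indices of roots: for the left side because the derivative of the
characteristic polynomial takes the value [\prod_(j != i) (a_i - a_j)] at
[a_i]. *)
Lemma det_horner_deriv_char_poly (n : nat) (A : 'M[int]_n.+1) :
  exists k, (\det (horner_mx A (char_poly A)^`()))%:~R = (-1) ^+ k * discrC A.
Proof.
pose a i := (char_roots A)`_i.
have chA : map_poly intr (char_poly A) = \prod_(i < n.+1) ('X - (a i)%:P) :> {poly algC}.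
  by rewrite char_rootsP (big_nth 0) size_char_roots big_mkord.
have deriv_root (i : 'I_n.+1) :
    (map_poly intr (char_poly A))^`().[a i] = \prod_(j | j != i) (a i - a j) :> algC.
  rewrite chA (bigD1 i) //= derivM derivXsubC mul1r hornerD hornerM hornerXsubC.
  by rewrite subrr mul0r addr0 horner_prod; apply: eq_bigr => j _; rewrite hornerXsubC.
exists (\sum_(i < n.+1) #|[pred j : 'I_n.+1 | (i < j)%N]|)%N.
rewrite -det_map_mx map_horner_mx -deriv_map.
rewrite (det_horner_mx _ _ _ _ (char_roots A)) -?map_char_poly ?char_rootsP //.
rewrite (big_nth 0) size_char_roots big_mkord -char_rootsP.
under eq_bigr => i _ do rewrite deriv_root (bigID (fun j : 'I_n.+1 => (i < j)%N)) /=.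
rewrite big_split /=.
have -> : \prod_(i < n.+1) \prod_(j < n.+1 | (j != i) && ~~ (i < j)%N) (a i - a j) =
    \prod_(i < n.+1) \prod_(j < n.+1 | (i < j)%N) (a j - a i).
  rewrite (exchange_big_dep xpredT) //=; apply: eq_bigr => i _.
  by apply: eq_bigl => j; rewrite -leqNgt ltn_neqAle.
rewrite -big_split -prodrXr -big_split /=; apply: eq_bigr => i _.
under eq_bigl => j.
  rewrite (_ : (j != i) && (i < j)%N = (i < j)%N); last first.
    by rewrite andbC andb_idr // => /gtn_eqF; rewrite -val_eqE => ->.
  over.
rewrite -prodrN -big_split /=; apply: eq_bigr => j _.
by rewrite expr2 -mulrN opprB.
Qed.

(** * Divisibility of the discriminant *)

(** Replacing column [k] of [M] by [M v] multiplies the determinant by [v k 0],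
which is prime to [p]. That column is [p w], so one factor [p] comes out and
leaves the matrix [N] with column [w]; then [v^T N] is divisible by [p], hence
so is [det N]. *)
Lemma sqr_dvd_det (p n : nat) (M : 'M[int]_n) (v : 'cV_n) (k : 'I_n) :
  prime p -> M^T = M -> ~~ (p %| v k 0%R)%Z ->
  (forall i, (p %| (M *m v) i 0%R)%Z) -> (p%:Z ^+ 2 %| (v^T *m M *m v) 0%R 0%R)%Z ->
  (p%:Z ^+ 2 %| \det M)%Z.
Proof.
move=> p_pr symM v_k Mv vMv.
have p_nz : p%:Z != 0 by rewrite -lt0n prime_gt0.
have co_pv : coprimez p (v k 0) by rewrite coprimezE prime_coprime.
have [w Mv_w] : exists w, M *m v = p%:Z *: w.
  exists (\col_i ((M *m v) i 0%R %/ p)%Z); apply/colP => i; rewrite !mxE mulrC.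
  by have := Mv i; rewrite dvdz_eq !mxE => /eqP.
pose N := \matrix_(i, j) (if j == k then w i 0 else M i j).
have detN : \det M * v k 0 = p%:Z * \det N.
  have := congr1 (fun x : 'cV_n => (\adj M *m x) k 0) Mv_w.
  rewrite mulmxA mul_adj_mx mul_scalar_mx mxE => ->.
  rewrite -scalemxAr mxE (expand_det_col N k) mxE; congr (_ * _).
  apply: eq_bigr => i _; rewrite !mxE eqxx mulrC; congr (_ * (_ * \det _)).
  by apply/matrixP=> a b; rewrite !mxE eq_sym (negPf (neq_lift _ _)).
(* Off column k this is [M v] by symmetry; at column k it is [v^T w], and
   [p v^T w = v^T M v]. *)
have vN j : (p %| (v^T *m N) 0%R j)%Z.
  rewrite mxE; have [->|jk] := eqVneq j k.
    rewrite -(dvdz_mul2l p_nz) -expr2.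
    suff <- : (v^T *m M *m v) 0 0 = p%:Z * \sum_i v^T 0 i * N i k by [].
    rewrite -mulmxA Mv_w -scalemxAr mxE; congr (_ * _); rewrite mxE.
    by apply: eq_bigr => i _; rewrite [N _ _]mxE eqxx.
  suff -> : \sum_i v^T 0 i * N i j = (M *m v) j 0 by [].
  by rewrite mxE; apply: eq_bigr => i _; rewrite !mxE (negPf jk) -{1}symM mxE mulrC.
have dvdN : (p %| \det N)%Z.
  rewrite -(Gauss_dvdzr _ co_pv).
  have -> : v k 0 * \det N = (v^T *m N *m \adj N) 0 k.
    by rewrite -mulmxA mul_mx_adj mul_mx_scalar !mxE mulrC.
  by rewrite mxE; apply: rpred_sum => j _; apply: dvdz_mulr.
rewrite -(@Gauss_dvdzl _ _ (v k 0)) ?coprimezXl // detN expr2.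
exact: dvdz_mul.
Qed.

Lemma mxOver_int_lift (R : archiNumDomainType) (m n : nat) (M : 'M[R]_(m, n)) :
  M \is a mxOver Num.int -> exists X : 'M[int]_(m, n), map_mx intr X = M.
Proof.
move=> Mint; exists (map_mx Num.floor M).
by apply/matrixP=> i j; rewrite !mxE floorK //; apply: (mxOverP Mint).
Qed.

(** Take for [l] the least common denominator of the entries: for a prime [p]
dividing [l], minimality prevents [p] from dividing all the entries of [l Q]. *)
Lemma rat_mx_level (m n : nat) (Q : 'M[rat]_(m, n)) :
  Q \isn't a mxOver Num.int ->
  exists p l (X : 'M[int]_(m, n)),
    [/\ prime p, (p %| l)%N, map_mx intr X = l%:R *: Q &
        exists i j, ~~ (p %| X i j)%Z].
Proof.
move=> Qnint; pose clears l := (0 < l)%N && ((l%:R *: Q) \is a mxOver Num.int).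
have ex_clears : exists l, clears l.
  exists (\prod_i \prod_j `|denq (Q i j)|)%N; apply/andP; split.
    by rewrite prodn_gt0 // => i; rewrite prodn_gt0 // => j; rewrite absz_gt0 denq_eq0.
  apply/mxOverP => i j; rewrite mxE (bigD1 i) //= (bigD1 j) //= !natrM mulrC !mulrA.
  by rewrite natr_absz (gtr0_norm (denq_gt0 _)) -numqE !rpredM ?intr_int ?natr_int.
case: (ex_minnP ex_clears) => l /andP[l_gt0 lQ] l_min.
have l_gt1 : (1 < l)%N.
  rewrite ltn_neqAle l_gt0 andbT; apply: contra Qnint => /eqP l1.
  by rewrite -l1 scale1r in lQ.
pose p := pdiv l; have p_pr : prime p := pdiv_prime l_gt1.
have p_l : (p %| l)%N := pdiv_dvd l.
have [X XE] := mxOver_int_lift _ _ _ _ lQ.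
exists p, l, X; split => //.
have [/existsP[i /existsP[j Xij]]|] := boolP [exists i, exists j, ~~ (p %| X i j)%Z].
  by exists i, j.
rewrite negb_exists => /forallP pX; exfalso; suff : clears (l %/ p)%N.
  move/l_min; rewrite leqNgt ltn_Pdiv ?prime_gt1 //.
rewrite /clears divn_gt0 ?prime_gt0 // dvdn_leq //=; apply/mxOverP=> i j.
have := pX i; rewrite negb_exists => /forallP/(_ j)/negPn/dvdzP[y Xy].
have := congr1 (fun M : 'M_(_, _) => M i j) XE; rewrite !mxE Xy.
rewrite -{1}(divnK p_l) natrM mulrAC intrM => /mulIf <- //.
by rewrite pnatr_eq0 -lt0n prime_gt0.
Qed.

(** The vector to which [sqr_dvd_det] applies is a column of [X = l Q] that does
not vanish mod [p]; the relations [X^T X = l ^ 2] and [A X = X B] give both of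
its hypotheses, the first one through the reduction mod [p]. *)
Lemma nonintegral_conj_sqr_dvd_discr (n : nat) (A : 'M[int]_n) (Q : 'M[rat]_n) :
  A^T = A -> in_OnQ Q -> in_SnZ (Q^T *m map_mx intr A *m Q) ->
  Q \isn't a mxOver Num.int ->
  exists2 p : nat, prime p & (p%:Z ^+ 2 %| discr A)%Z.
Proof.
case: n A Q => [|n] A Q symA orthQ [_ intB] Qnint.
  by case/negP: Qnint; apply/mxOverP=> -[].
have [p [l [X [p_pr p_l XE [i [j Xij]]]]]] := rat_mx_level _ _ _ Qnint.
exists p => //.
have intr_mx_inj : injective (fun M : 'M[int]_n.+1 => map_mx intr M : 'M[rat]_n.+1).
  by move=> M N /matrixP MN; apply/matrixP=> a b; have := MN a b; rewrite !mxE => /intr_inj.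
have [B BE] := mxOver_int_lift _ _ _ _ intB.
have QQ : Q^T *m Q = 1%:M := orthQ.
have XX : X^T *m X = ((l%:Z) ^+ 2)%:M.
  apply: intr_mx_inj; rewrite map_mxM -map_trmx XE map_scalar_mx rmorphXn /=.
  rewrite [(_ *: Q)^T]linearZ /= -scalemxAl -scalemxAr QQ scalerA -expr2.
  by rewrite scale_scalar_mx mulr1.
have AX : A *m X = X *m B.
  apply: intr_mx_inj; rewrite !map_mxM XE BE -scalemxAl -scalemxAr !mulmxA.
  by rewrite (mulmx1C QQ) mul1mx.
have XA : X^T *m A = B^T *m X^T by rewrite -[in LHS]symA -!trmx_mul AX.
pose M := horner_mx A (char_poly A)^`().
have XM : X^T *m M = horner_mx B^T (char_poly A)^`() *m X^T.
  exact: horner_mx_intertwine.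
have symM : M^T = M by rewrite trmx_horner_mx symA.
have [k discE] := det_horner_deriv_char_poly _ A.
have {discE} -> : discr A = (-1) ^+ k * \det M.
  apply: (@intr_inj algC); rewrite discrE // rmorphM rmorphXn rmorphN rmorph1 /=.
  by rewrite discE mulrA -exprD addnn -mul2n exprM sqrrN !expr1n mul1r.
apply: dvdz_mull; apply: (sqr_dvd_det _ _ _ (col j X) i) => //.
- by rewrite mxE.
- move=> a; have p_char : p \in [pchar 'F_p] := pchar_Fp p_pr.
  pose red m m' (N : 'M[int]_(m, m')) := map_mx (intr : int -> 'F_p) N.
  have XM0 : red _ _ X^T *m horner_mx (red _ _ A) (char_poly (red _ _ A))^`() = 0.
    apply: (isotropic_deriv_char_poly _ _ _ _ _ (red _ _ B^T)).
    + by rewrite /red map_trmx symA.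
    + by rewrite /red -!map_mxM XA.
    + rewrite /red map_trmx trmxK -map_mxM XX map_scalar_mx rmorphXn /=.
      have /eqP -> : (l%:Z)%:~R == 0 :> 'F_p by rewrite -(dvdz_pcharf p_char).
      by rewrite expr0n raddf0.
  have := congr1 (fun N : 'M_(_, _) => N j a) XM0.
  rewrite /red -map_char_poly deriv_map -map_horner_mx -map_mxM !mxE => /eqP.
  rewrite -(dvdz_pcharf p_char) -/M; congr (_ %| _)%Z.
  by apply: eq_bigr => b _; rewrite -[in RHS]symM !mxE mulrC.
have -> : (col j X)^T *m M *m col j X =
    (l%:Z ^+ 2 * horner_mx B^T (char_poly A)^`() j j)%:M.
  have -> : (col j X)^T *m M *m col j X = row j (X^T *m M *m col j X).
    by rewrite !row_mul tr_col.
  rewrite colE mulmxA XM -[_ *m X^T *m X]mulmxA XX mul_mx_scalar.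
  by apply/rowP=> a; rewrite !ord1 mxE -scalemxAl -colE !mxE eqxx.
by rewrite mxE eqxx; apply: dvdz_mulr; apply: dvdz_exp2r.
Qed.

(** * Integral orthogonal matrices *)

(** A nonzero integer has square at least 1, so one nonzero [x i] already uses up
the whole sum. *)
Lemma unit_sum_sqr (n : nat) (x : 'I_n -> int) :
  \sum_i x i ^+ 2 = 1 ->
  (exists! i, x i != 0) /\ forall i, x i != 0 -> x i = 1 \/ x i = -1.
Proof.
move=> sum1.
have [i nz_i] : exists i, x i != 0.
  apply/existsP; apply: contra_eqT sum1; rewrite negb_exists => /forallP x0.
  by rewrite big1 // => i _; have /negPn/eqP-> := x0 i; rewrite expr0n.
have sqr_ge1 : 1 <= x i ^+ 2 by rewrite -gtz0_ge1 lt_neqAle eq_sym sqrf_eq0 nz_i sqr_ge0.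
have rest0 : \sum_(j | j != i) x j ^+ 2 = 0.
  apply/eqP; rewrite eq_le sumr_ge0 ?andbT => [|j _]; last exact: sqr_ge0.
  by move: sqr_ge1; rewrite -sum1 (bigD1 i) //= gerDl.
have other j : j != i -> x j = 0.
  move=> ji; apply/eqP; rewrite -sqrf_eq0; apply/eqP.
  by apply: (psumr_eq0P _ rest0) => // k _; exact: sqr_ge0.
split; first by exists i; split=> // j; apply: contra_neq_eq => /[1!eq_sym]/other->.
move=> j nz_j; have [ji|/other xj0] := eqVneq j i; last by rewrite xj0 eqxx in nz_j.
move: sum1; rewrite (bigD1 i) //= rest0 addr0 -ji => /eqP.
by rewrite sqrf_eq1 => /orP[] /eqP->; [left|right].
Qed.

Lemma integral_orth_signed_perm (n : nat) (Q : 'M[rat]_n) :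
  in_OnQ Q -> Q \is a mxOver Num.int -> signed_perm_mx Q.
Proof.
move=> orthQ Qint; have [X XE] := mxOver_int_lift _ _ _ _ Qint.
have QX i j : Q i j = (X i j)%:~R by rewrite -XE mxE.
have QQ : Q^T *m Q = 1%:M := orthQ.
have col1 j : \sum_i X i j ^+ 2 = 1.
  apply: (@intr_inj rat); rewrite rmorph1.
  have := congr1 (fun M : 'M_n => M j j) QQ.
  rewrite !mxE eqxx mulr1n => QQ1; rewrite -[RHS]QQ1 rmorph_sum /=; apply: eq_bigr => i _.
  by rewrite mxE QX rmorphXn expr2.
have row1 i : \sum_j X i j ^+ 2 = 1.
  apply: (@intr_inj rat); rewrite rmorph1.
  have := congr1 (fun M : 'M_n => M i i) (mulmx1C QQ).
  rewrite !mxE eqxx mulr1n => QQ1; rewrite -[RHS]QQ1 rmorph_sum /=; apply: eq_bigr => j _.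
  by rewrite mxE QX rmorphXn expr2.
split=> [i|j|i j].
- have [[j [nz_j uniq_j]] _] := unit_sum_sqr _ _ (row1 i).
  by exists j; split=> [|j']; rewrite QX intr_eq0 //; apply: uniq_j.
- have [[i [nz_i uniq_i]] _] := unit_sum_sqr _ _ (col1 j).
  by exists i; split=> [|i']; rewrite QX intr_eq0 //; apply: uniq_i.
rewrite QX intr_eq0; have [_ pm1] := unit_sum_sqr _ _ (row1 i).
by case/pm1=> ->; [left|right].
Qed.

Theorem theorem1p4 (n : nat) (A : 'M[int]_n) (symA : A^T = A)
    (oddD : odd `|discr A|%N) (sqfD : squarefreez (discr A))
    (Q : 'M[rat]_n) (orthQ : in_OnQ Q)
    (conjQ : in_SnZ (Q^T *m map_mx intr A *m Q)) :
  signed_perm_mx Q.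
Proof.
apply: integral_orth_signed_perm => //; apply: contraT => Qnint.
have [p p_pr /sqfD p_unit] :=
  nonintegral_conj_sqr_dvd_discr _ _ _ symA orthQ conjQ Qnint.
have p1 : p = 1%N by case: p_unit => // [[]].
by rewrite p1 in p_pr.
Qed.
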